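(* Let $N\in\mathbb{N}$, let $X,Y\in\{0,1\}^N$ be random vectors, let $h:\{0,1\}^N\to\mathbb{R}$, and assume that the continuous time Glauber dynamics for $\mathcal{L}(X)$ is irreducible. For $s\in[N]$, set $c_s:=\|\Delta_s h\|$ and $v_s(y):=|q_X(y^{(s,1)}|y)-q_Y(y^{(s,1)}|y)|$, and let $c:=(c_1,\ldots,c_N)$ and $v(Y):=(v_1(Y),\ldots,v_N(Y))$. Assume that there is an $N\times N$ matrix $R$ such that for all $r,s\in[N]$, and some $1\le p\le\infty$ and $\varepsilon=\varepsilon_p>0$, $$\hat R_{rs}\le R_{rs},\qquad\text{and}\qquad \|R\|_p\le 1-\varepsilon<1,$$ where $\hat R$ is the influence matrix for the Glauber dynamics of $\mathcal{L}(X)$. Then for $q:=p/(p-1)$ (with the usual conventions $q=\infty$ if $p=1$ and $q=1$ if $p=\infty$), $$\left|\mathbb{E}h(X)-\mathbb{E}h(Y)\right|\le \varepsilon^{-1}\,\|c\|_q\,\mathbb{E}\|v(Y)\|_p.$$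
   Context: $[N]=\{1,\dots,N\}$; $\mathcal{L}(W)$ denotes the law of $W$. For $x\in\{0,1\}^N$ and $s\in[N]$, $x^{(s,1)}$ (respectively $x^{(s,0)}$) denotes the vector equal to $x$ except that its $s$th coordinate is set to $1$ (respectively $0$). For $g:\{0,1\}^N\to\mathbb{R}$, $\Delta_s g(x):=g(x^{(s,1)})-g(x^{(s,0)})$ and $\|\cdot\|$ (without subscript) is the supremum norm. For a random vector $W\in\{0,1\}^N$, $q_W(x^{(s,1)}|x):=\mathbb{P}(W_s=1\mid (W_u)_{u\ne s}=(x_u)_{u\ne s})$. Continuous time Glauber dynamics for $\mathcal{L}(X)$: the continuous time Markov chain on $\{0,1\}^N$ with exponential rate $1$ holding times which at each jump time, from state $x$, chooses $s\in[N]$ uniformly at random and moves to $x^{(s,1)}$ with probability $q_X(x^{(s,1)}|x)$ and to $x^{(s,0)}$ otherwise; i.e. its generator is $\mathcal{A}f(x)=\frac1N\sum_{s\in[N]}\left[q_X(x^{(s,1)}|x)\Delta_sf(x)+(f(x^{(s,0)})-f(x))\right]$. Influence matrix: $\hat R$ is the $N\times N$ matrix with entries $$\hat R_{rs}:=\max_{x\in\{0,1\}^N}\left|q_X\left((x^{(s,1)})^{(r,1)}\,\middle|\,x^{(s,1)}\right)-q_X\left((x^{(s,0)})^{(r,1)}\,\middle|\,x^{(s,0)}\right)\right|.$$ For $1\le p\le\infty$, $\|\cdot\|_p$ is the $p$-norm on $\mathbb{R}^N$, and for a matrix $A$, $\|A\|_p:=\sup_{v\ne0}\|Av\|_p/\|v\|_p$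 is the operator $p$-norm. *)

(* Defs.v *)
From HB Require Import structures.
From mathcomp Require Export all_boot all_order all_algebra.
From mathcomp Require Export all_classical all_reals all_analysis.
Export Order.TTheory GRing.Theory Num.Theory.
Export numFieldNormedType.Exports.

Set Implicit Arguments.
Unset Strict Implicit.
Unset Printing Implicit Defensive.

Local Open Scope classical_set_scope.
Local Open Scope ring_scope.

Notation cube N := (N.-tuple bool).

Section Cube.
Context {R : realType} {N : nat}.
Implicit Types (x y : cube N) (s : 'I_N) (f : cube N -> R).

(* $x^{(s,b)}$ *)
Definition set_coord x s (b : bool) : cube N :=
  [tuple if u == s then b else tnth x u | u < N].

Definition Delta s f x : R := f (set_coord x s true) - f (set_coord x s false).

Definition supnorm f : R := \big[Num.max/0]_(x : cube N) `|f x|.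

End Cube.

Section Conditional.
Context {d : measure_display} {T : measurableType d} {R : realType}.

(* Elementary conditional probability; its value is 0 when [P B = 0]. *)
Definition cond_prob (P : probability T R) (A B : set T) : R :=
  fine (P (A `&` B)) / fine (P B).

(* $q_W(x^{(s,1)} | x)$ *)
Definition qcond (P : probability T R) (N : nat) (W : {RV P >-> cube N})
    (s : 'I_N) (x : cube N) : R :=
  cond_prob P [set w | tnth (W w) s = true]
              [set w | forall u, u != s -> tnth (W w) u = tnth x u].

End Conditional.

(* [q s x] stands for the conditional probability $q(x^{(s,1)} | x)$. *)
Section Glauber.
Context {R : realType} {N : nat} (q : 'I_N -> cube N -> R).

Definition glauber_generator (f : cube N -> R) (x : cube N) : R :=
  N%:R^-1 * \sum_(s < N)
    (q s x * Delta s f x + (f (set_coord x s false) - f x)).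

(* The transition semigroup $e^{t\mathcal{A}}$; the state space being finite,
   the exponential series of the generator always converges. *)
Definition glauber_semigroup (t : R) (f : cube N -> R) (x : cube N) : R :=
  limn (series (fun n : nat => t ^+ n / n`!%:R * iter n glauber_generator f x)).

Definition glauber_transition (t : R) (x y : cube N) : R :=
  glauber_semigroup t (fun z => (z == y)%:R) x.

Definition glauber_irreducible : Prop :=
  forall x y : cube N, exists2 t : R, 0 <= t & 0 < glauber_transition t x y.

Definition influence_matrix : 'M[R]_N :=
  \matrix_(r, s) \big[Num.max/0]_(x : cube N)
    `|q r (set_coord x s true) - q r (set_coord x s false)|.

End Glauber.

Section PNorm.
Context {R : realType} {N : nat}.

(* Meant for [1 <= p]. *)
Definition pnorm (p : \bar R) (v : 'cV[R]_N) : R :=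
  match p with
  | r%:E => (\sum_i `|v i 0| `^ r) `^ r^-1
  | +oo%E => \big[Num.max/0]_i `|v i 0|
  | -oo%E => 0
  end.

Definition op_pnorm (p : \bar R) (A : 'M[R]_N) : R :=
  sup [set pnorm p (A *m v) / pnorm p v | v in [set v : 'cV[R]_N | v != 0]].

End PNorm.

(* Main.v *)
(* Let Q be one step of the discrete time Glauber chain of X, that is Q = 1 + A,
   and D(g) the vector of the sup norms of the Delta_s g. Coupling two copies of
   the chain at the updated site gives
   D(Q g) <= ((1 - 1/N) I + R^T / N) D(g) entrywise. Hence for u >= 0, by
   Hoelder's inequality and the bound on ||R||_p,
     u . D(Q^k h) <= ||c||_q ||((1 - 1/N) I + R / N)^k u||_p
                  <= ||c||_q (1 - eps / N)^k ||u||_p.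
   The law of X is invariant under Q, so
     E h(X) - E h(Y) = (E Q^k h(X) - E Q^k h(Y)) + sum_(j < k) E (A Q^j h)(Y).
   The first term vanishes as k grows since the oscillation of Q^k h is at most
   1 . D(Q^k h). As the generator of the Glauber dynamics of Y has mean zero under
   the law of Y, E (A g)(Y) is at most E (v(Y) . D(g)) / N in absolute value, and
   summing the geometric series gives the factor 1 / eps. *)
Require Import Defs.
From mathcomp Require Import ring.

Set Implicit Arguments.
Unset Strict Implicit.
Unset Printing Implicit Defensive.

Local Open Scope classical_set_scope.
Local Open Scope ring_scope.

(** * Real powers: monotonicity, quotients and convexity *)

Section PowR.
Context {R : realType}.
Implicit Types r x y : R.

Lemma le_powR2 r x y : 0 < r -> 0 <= x -> x <= y -> x `^ r <= y `^ r.
Proof.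
move=> r0 x0 xy.
by apply: (ge0_ler_powR (ltW r0)) => //; rewrite nnegrE// (le_trans x0).
Qed.

Lemma powR_div r x y : 0 <= x -> 0 <= y -> (x / y) `^ r = x `^ r / y `^ r.
Proof.
by move=> x0 y0; rewrite powRM ?invr_ge0// -(powR_inv1 y0) -powRrM mulN1r powRN.
Qed.

Lemma powR_convex_comb r t x y : 1 <= r -> 0 <= t <= 1 -> 0 <= x -> 0 <= y ->
  (t * x + (1 - t) * y) `^ r <= t * x `^ r + (1 - t) * y `^ r.
Proof.
move=> r1 /andP[t0 t1] x0 y0.
have := convex_powR r1 (Itv01 t0 t1) (x := x) (y := y).
rewrite !inE/= !in_itv/= !andbT => /(_ x0 y0).
by rewrite !convRE.
Qed.

End PowR.

(** * Finite-dimensional p-norms: Minkowski, operator bound, Hoelder *)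

Section PNormTheory.
Context {R : realType} {N : nat}.
Implicit Types (p : \bar R) (r : R) (u v w : 'cV[R]_N).

(** Separates the finite exponents, where [pnorm] is a root of a sum of powers, from the infinite
    one, where it is a maximum. *)
Lemma ereal_ge1_ind (P : \bar R -> Prop) :
  (forall r, 1 <= r -> P r%:E) -> P +oo%E -> forall p, (1 <= p)%E -> P p.
Proof.
move=> Pr Py [r| |]; first by rewrite lee_fin; exact: Pr.
  by move=> _; exact: Py.
by rewrite leNgt ltNyr.
Qed.

Lemma pnorm_ge0 p v : 0 <= pnorm p v.
Proof. by case: p => [r||]//=; rewrite ?powR_ge0// bigmax_ge_id. Qed.

Lemma pnorm_powR r v : 0 < r -> pnorm r%:E v `^ r = \sum_i `|v i 0| `^ r.
Proof.
move=> r0; rewrite /= -powRrM mulVf ?gt_eqF// powRr1//.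
by apply: sumr_ge0 => i _; exact: powR_ge0.
Qed.

(** Lets upper bounds be checked on [r]-th powers, where the outer root is gone and sums can be
    compared term by term. *)
Lemma pnorm_finE r v b : 0 < r -> 0 <= b ->
  (pnorm r%:E v <= b) = (\sum_i `|v i 0| `^ r <= b `^ r).
Proof.
move=> r0 b0; rewrite -pnorm_powR//; apply/idP/idP => [|le_pow].
  by apply: le_powR2 => //; exact: pnorm_ge0.
rewrite leNgt; apply/negP => /(gt0_ltr_powR r0).
by rewrite !nnegrE b0 pnorm_ge0 => /(_ isT isT); rewrite ltNge le_pow.
Qed.

Lemma norm_le_pnorm p v i : (1 <= p)%E -> `|v i 0| <= pnorm p v.
Proof.
move: p; apply: ereal_ge1_ind => [r r1|]; last first.
  exact: (le_bigmax _ (fun i => `|v i 0|)).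
have r0 : 0 < r by rewrite (lt_le_trans _ r1).
rewrite leNgt; apply/negP => /(gt0_ltr_powR r0).
rewrite !nnegrE powR_ge0 normr_ge0 => /(_ isT isT).
rewrite -/(pnorm r%:E v) pnorm_powR// ltNge => /negP; apply.
by rewrite (bigD1 i)//= lerDl sumr_ge0// => j _; exact: powR_ge0.
Qed.

Lemma le_pnorm p u v : (1 <= p)%E -> (forall i, `|u i 0| <= `|v i 0|) ->
  pnorm p u <= pnorm p v.
Proof.
move=> + uv; move: p; apply: ereal_ge1_ind => [r r1|]; last exact: le_bigmax2.
have r0 : 0 < r by rewrite (lt_le_trans _ r1).
rewrite pnorm_finE ?pnorm_ge0// pnorm_powR//.
by apply: ler_sum => i _; exact: le_powR2.
Qed.

Lemma pnormZ p a v : (1 <= p)%E -> 0 <= a -> pnorm p (a *: v) = a * pnorm p v.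
Proof.
move=> + a0; move: p; apply: ereal_ge1_ind => [r r1|] /=.
  have r0 : 0 < r by rewrite (lt_le_trans _ r1).
  under eq_bigr do rewrite mxE normrM (ger0_norm a0) powRM//.
  rewrite -mulr_sumr powRM ?powR_ge0 ?sumr_ge0//.
  by rewrite -powRrM mulfV ?gt_eqF// powRr1.
apply/eqP; rewrite eq_le; apply/andP; split.
  apply: bigmax_le => [|i _]; first by rewrite mulr_ge0// bigmax_ge_id.
  rewrite mxE normrM (ger0_norm a0) ler_wpM2l//.
  exact: (le_bigmax _ (fun i => `|v i 0|)).
(* The lower bound on the maximum divides by [a], so [a = 0] is treated apart. *)
have [->|a_neq0] := eqVneq a 0; first by rewrite mul0r bigmax_ge_id.
have a_gt0 : 0 < a by rewrite lt0r a_neq0.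
rewrite mulrC -ler_pdivlMr//; apply: bigmax_le => [|i _].
  by rewrite divr_ge0// bigmax_ge_id.
rewrite ler_pdivlMr// mulrC -{1}(ger0_norm a0) -normrM.
by have := le_bigmax 0 (fun i => `|(a *: v) i 0|) i; rewrite mxE.
Qed.

Lemma pnorm0 p : (1 <= p)%E -> pnorm p (0 : 'cV[R]_N) = 0.
Proof. by move=> p1; rewrite -(scale0r 0) pnormZ// mul0r. Qed.

Lemma pnorm_eq0 p v : (1 <= p)%E -> (pnorm p v == 0) = (v == 0).
Proof.
move=> p1; apply/eqP/eqP => [v0|->]; last exact: pnorm0.
apply/matrixP => i j; rewrite ord1 mxE; apply/eqP.
by rewrite -normr_le0 -v0 norm_le_pnorm.
Qed.

Lemma pnorm_gt0 p v : (1 <= p)%E -> (0 < pnorm p v) = (v != 0).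
Proof. by move=> p1; rewrite lt0r pnorm_ge0 andbT pnorm_eq0. Qed.

(** For a finite exponent, let [a] and [b] be the two norms. Dividing [|u i| + |v i|] by [a + b]
    gives the convex combination of [|u i| / a] and [|v i| / b] with weight [t = a / (a + b)].
    Convexity of the [r]-th power applies, and the [r]-th powers of the normalised entries sum to
    1. *)
Lemma pnormD p u v : (1 <= p)%E -> pnorm p (u + v) <= pnorm p u + pnorm p v.
Proof.
move=> p1.
have [->|u0] := eqVneq u 0; first by rewrite add0r pnorm0// add0r.
have [->|v0] := eqVneq v 0; first by rewrite addr0 pnorm0// addr0.
move: u0 v0; rewrite -(pnorm_gt0 u p1) -(pnorm_gt0 v p1).
move: p p1; apply: ereal_ge1_ind => [r r1|]; last first.
  move=> _ _.
  apply: bigmax_le => [|i _]; first by rewrite addr_ge0// bigmax_ge_id.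
  rewrite mxE (le_trans (ler_normD _ _))// lerD//.
    exact: (le_bigmax _ (fun i => `|u i 0|)).
  exact: (le_bigmax _ (fun i => `|v i 0|)).
have r0 : 0 < r by rewrite (lt_le_trans _ r1).
have [a aE] : {a | a = pnorm r%:E u} := exist _ _ erefl.
have [b bE] : {b | b = pnorm r%:E v} := exist _ _ erefl.
rewrite -aE -bE => a0 b0.
have ab0 : 0 < a + b by rewrite addr_gt0.
rewrite pnorm_finE ?(ltW ab0)//.
pose t := a / (a + b).
have t01 : 0 <= t <= 1.
  by rewrite /t divr_ge0 ?(ltW a0) ?(ltW ab0)//= ler_pdivrMr// mul1r lerDl ltW.
have tE : 1 - t = b / (a + b) by rewrite /t; field; rewrite gt_eqF.
have key i : `|(u + v) i 0| `^ r <=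
    (a + b) `^ r * (t * (`|u i 0| `^ r / a `^ r) +
                    (1 - t) * (`|v i 0| `^ r / b `^ r)).
  rewrite -!powR_div ?(ltW a0) ?(ltW b0)//.
  apply: le_trans (_ : ((a + b) * (t * (`|u i 0| / a) + (1 - t) * (`|v i 0| / b))) `^ r <= _).
    apply: le_powR2 => //.
    rewrite mxE (le_trans (ler_normD _ _))//.
    by rewrite le_eqVlt; apply/orP; left; apply/eqP; rewrite tE /t; field; rewrite !gt_eqF.
  rewrite powRM ?(ltW ab0)//; last first.
    rewrite tE /t.
    by apply: addr_ge0; rewrite !(mulr_ge0, invr_ge0, ltW a0, ltW b0, ltW ab0, normr_ge0).
  rewrite ler_wpM2l ?powR_ge0// powR_convex_comb// divr_ge0// ltW//.
apply: le_trans (ler_sum _ (fun i _ => key i)) _.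
rewrite -mulr_sumr big_split/= -!mulr_sumr -!mulr_suml -!pnorm_powR//.
rewrite -aE -bE !divff ?gt_eqF ?powR_gt0// !mulr1.
by rewrite addrC subrK mulr1.
Qed.

Lemma pnorm_mulmx_le p (A : 'M[R]_N) v : (1 <= p)%E ->
  pnorm p (A *m v) <= op_pnorm p A * pnorm p v.
Proof.
move=> p1; have [->|v0] := eqVneq v 0; first by rewrite mulmx0 pnorm0// mulr0.
have pv0 : 0 < pnorm p v by rewrite pnorm_gt0.
rewrite -ler_pdivrMr//; apply: ub_le_sup; last by exists v.
(* The real [sup] is an upper bound only for a set bounded above. A crude bound suffices: entries of
   [w] are at most its norm, so [A *m w] is dominated by a constant vector. *)
exists ((\sum_i \sum_j `|A i j|) * pnorm p (const_mx 1 : 'cV_N)) => _ [w /= w0 <-].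
have pw0 : 0 < pnorm p w by rewrite pnorm_gt0.
rewrite ler_pdivrMr// -mulrA [X in _ <= _ * X]mulrC mulrA -pnormZ//; last first.
  by rewrite mulr_ge0// ?pnorm_ge0// sumr_ge0// => i _; rewrite sumr_ge0.
apply: le_pnorm => // i; rewrite !mxE mulr1 [X in _ <= X]ger0_norm; last first.
  by rewrite mulr_ge0// ?pnorm_ge0// sumr_ge0// => j _; rewrite sumr_ge0.
rewrite (le_trans (ler_norm_sum _ _ _))// [X in _ <= X * _](bigD1 i)//=.
rewrite mulrDl -[X in X <= _]addr0.
rewrite lerD//.
  rewrite mulr_suml ler_sum// => j _; rewrite normrM ler_wpM2l//.
  exact: norm_le_pnorm.
by rewrite mulr_ge0// ?pnorm_ge0// sumr_ge0// => j _; rewrite sumr_ge0.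
Qed.

(** For [1 < p] finite, Young's inequality is applied to the entries divided by their norms and then
    summed. The exponents 1 and infinity are the same estimate with the two factors exchanged. *)
Lemma hoelder_pnorm p u v : (1 <= p)%E ->
  \sum_i `|u i 0| * `|v i 0| <= pnorm (hoelder_conjugate p) u * pnorm p v.
Proof.
have h1y (x y : 'cV[R]_N) :
    \sum_i `|x i 0| * `|y i 0| <= pnorm 1%E x * pnorm +oo%E y.
  rewrite /= invr1 powRr1; last by apply: sumr_ge0 => i _; exact: powR_ge0.
  rewrite mulr_suml ler_sum// => i _; rewrite powRr1// ler_wpM2l//.
  exact: (le_bigmax _ (fun i => `|y i 0|)).
move: p; apply: ereal_ge1_ind => [r|]; last first.
  by rewrite hoelder_conjugatey; exact: h1y.
rewrite le_eqVlt => /predU1P[<-|r1].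
  rewrite hoelder_conjugate1 mulrC; under eq_bigr do rewrite mulrC; exact: h1y.
have r0 : 0 < r by rewrite (lt_trans _ r1).
pose q := r / (r - 1).
have q0 : 0 < q by rewrite divr_gt0// subr_gt0.
have q1 : (1 <= q%:E)%E by rewrite lee_fin ler_pdivlMr ?subr_gt0// mul1r gerBl.
have p1 : (1 <= r%:E)%E by rewrite lee_fin ltW.
have -> : hoelder_conjugate r%:E = q%:E.
  by rewrite /hoelder_conjugate/= eqe gt_eqF// -EFinD inver subr_eq0 gt_eqF.
have qr : q^-1 + r^-1 = 1.
  by rewrite /q; field; rewrite !gt_eqF// subr_gt0.
have [->|u0] := eqVneq u 0.
  by rewrite (pnorm0 q1) mul0r big1// => i _; rewrite mxE normr0 mul0r.
have [->|v0] := eqVneq v 0.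
  by rewrite (pnorm0 p1) mulr0 big1// => i _; rewrite mxE normr0 mulr0.
move: u0 v0; rewrite -(pnorm_gt0 u q1) -(pnorm_gt0 v p1).
have [a aE] : {a | a = pnorm q%:E u} := exist _ _ erefl.
have [b bE] : {b | b = pnorm r%:E v} := exist _ _ erefl.
rewrite -aE -bE => a0 b0.
have ab0 : 0 < a * b by rewrite mulr_gt0.
rewrite -[a * b]mul1r -ler_pdivrMr// -qr mulr_suml.
apply: le_trans (_ : \sum_i (`|u i 0| `^ q / a `^ q / q +
                            `|v i 0| `^ r / b `^ r / r) <= _).
  apply: ler_sum => i _.
  rewrite -!powR_div ?(ltW a0) ?(ltW b0)//.
  apply: le_trans (conjugate_powR _ _ q0 r0 qr); rewrite ?divr_ge0 ?(ltW a0) ?(ltW b0)//.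
  by rewrite invfM mulrACA.
rewrite big_split/= -!mulr_suml -!pnorm_powR// -aE -bE.
by rewrite !divff ?gt_eqF ?powR_gt0// !mul1r.
Qed.

End PNormTheory.

(** * Updating coordinates of a point of the cube *)

Section SetCoord.
Context {N : nat}.
Implicit Types (x y : cube N) (s r u : 'I_N).

Lemma tnth_set_coord x s b u :
  tnth (set_coord x s b) u = if u == s then b else tnth x u.
Proof. by rewrite tnth_mktuple. Qed.

Lemma set_coordK x s a b : set_coord (set_coord x s a) s b = set_coord x s b.
Proof.
by apply: eq_from_tnth => u; rewrite !tnth_set_coord; case: (u == s).
Qed.

Lemma set_coordC x s r a b : s != r ->
  set_coord (set_coord x s a) r b = set_coord (set_coord x r b) s a.
Proof.
move=> sr; apply: eq_from_tnth => u; rewrite !tnth_set_coord.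
by have [->|//] := eqVneq u r; rewrite eq_sym (negbTE sr).
Qed.

Lemma set_coord_id x s : set_coord x s (tnth x s) = x.
Proof.
by apply: eq_from_tnth => u; rewrite tnth_set_coord; case: eqP => // ->.
Qed.

(** Provides a path between two arbitrary points along which one coordinate is updated at a time. *)
Lemma foldl_set_coord_enum x y :
  foldl (fun z s => set_coord z s (tnth y s)) x (enum 'I_N) = y.
Proof.
(* Generalised to an arbitrary list of sites, so that induction on the list goes through. *)
suff foldE (l : seq 'I_N) z u :
    tnth (foldl (fun z s => set_coord z s (tnth y s)) z l) u =
    if u \in l then tnth y u else tnth z u.
  by apply: eq_from_tnth => u; rewrite foldE mem_enum.
elim: l z => [//|s l IH] z /=; rewrite IH in_cons tnth_set_coord.
by case: (u \in l); rewrite ?orbT ?orbF//; case: eqP => // ->.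
Qed.

End SetCoord.

(** * Oscillation of functions and sums over the cube *)

Section CubeFunctions.
Context {R : realType} {N : nat}.
Implicit Types (x y : cube N) (s : 'I_N) (g : cube N -> R).

Lemma supnorm_ge0 g : 0 <= supnorm g.
Proof. exact: bigmax_ge_id. Qed.

Lemma norm_le_supnorm g x : `|g x| <= supnorm g.
Proof. exact: (le_bigmax _ (fun x => `|g x|)). Qed.

Lemma supnorm_le g b : 0 <= b -> (forall x, `|g x| <= b) -> supnorm g <= b.
Proof. by move=> b0 gb; apply: bigmax_le. Qed.

Lemma norm_sub_set_coord g x s b :
  `|g x - g (set_coord x s b)| <= supnorm (Delta s g).
Proof.
rewrite -{1}(set_coord_id x s).
case: (tnth x s); case: b; rewrite ?subrr ?normr0 ?supnorm_ge0//.
  exact: (norm_le_supnorm (Delta s g)).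
rewrite distrC; exact: (norm_le_supnorm (Delta s g)).
Qed.

(** Telescopes along the path from [x] to [y]: updating site [s] costs at most the sup norm of
    [Delta s g], and each site is updated once. *)
Lemma norm_sub_cube g x y : `|g x - g y| <= \sum_s supnorm (Delta s g).
Proof.
rewrite -(foldl_set_coord_enum x y) -big_enum/=.
elim: (enum 'I_N) x => [|s l IH] x /=; first by rewrite subrr normr0 big_nil.
rewrite big_cons; set z := set_coord x s (tnth y s).
apply: le_trans (ler_distD (g z) _ _) _.
by rewrite lerD// norm_sub_set_coord.
Qed.

Lemma norm_mean_sub_cube g (m : cube N -> R) y :
  (forall x, 0 <= m x) -> \sum_x m x = 1 ->
  `|\sum_x m x * g x - g y| <= \sum_s supnorm (Delta s g).
Proof.
move=> m0 m1; rewrite -[g y]mul1r -m1 mulr_suml -sumrB.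
apply: le_trans (ler_norm_sum _ _ _) _.
rewrite -[leRHS]mul1r -m1 mulr_suml; apply: ler_sum => x _.
by rewrite -mulrBr normrM ger0_norm// ler_wpM2l// norm_sub_cube.
Qed.

(** Groups the points into pairs differing only at [s], each represented by its member with a 0
    there. Resampling at [s] acts within each pair. *)
Lemma sum_cube_pair s (F : cube N -> R) :
  \sum_x F x =
  \sum_(x | ~~ tnth x s) (F (set_coord x s true) + F (set_coord x s false)).
Proof.
rewrite (bigID (fun x : cube N => tnth x s))/= addrC big_split/= addrC; congr (_ + _).
  rewrite (reindex_onto (fun x => set_coord x s true)
                        (fun x => set_coord x s false)) => [|x xs]/=; last first.
    by rewrite set_coordK -{2}(set_coord_id x s) xs.
  apply: eq_bigl => x; rewrite tnth_set_coord eqxx/= set_coordK.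
  apply/eqP/idP => [<-|xs]; first by rewrite tnth_set_coord eqxx.
  by rewrite -{2}(set_coord_id x s) (negbTE xs).
by apply: eq_bigr => x xs; rewrite -{1}(set_coord_id x s) (negbTE xs).
Qed.

End CubeFunctions.

(** * Single-site resampling and one step of the discrete Glauber chain *)

Section Resample.
Context {R : realType} {N : nat}.
Implicit Types (q : 'I_N -> cube N -> R) (m g : cube N -> R) (x : cube N).

Definition resample q s g x : R :=
  q s x * g (set_coord x s true) + (1 - q s x) * g (set_coord x s false).

Definition glauber_step q g x : R := g x + glauber_generator q g x.

Lemma glauber_generatorE q g x :
  glauber_generator q g x = N%:R^-1 * \sum_(s < N) (resample q s g x - g x).
Proof.
by congr (_ * _); apply: eq_bigr => s _; rewrite /resample /Delta; ring.
Qed.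

Lemma glauber_stepE q g x : (0 < N)%N ->
  glauber_step q g x = N%:R^-1 * \sum_(s < N) resample q s g x.
Proof.
move=> N0; rewrite /glauber_step glauber_generatorE sumrB sumr_const card_ord.
rewrite -[g x *+ N]mulr_natl mulrBr mulKf ?subrKC//.
by rewrite pnatr_eq0 -lt0n.
Qed.

(* [q s x] is the conditional probability of a [1] at [s] under the weights
   [m], multiplied out so that a null conditioning event imposes nothing. *)
Definition conditional_of m q :=
  forall s x, q s x * (m (set_coord x s true) + m (set_coord x s false)) =
              m (set_coord x s true).

(** Expresses that the conditioning at [s] involves the other coordinates only, so both members of a
    pair differing at [s] are resampled alike. *)
Definition single_site q :=
  forall s x b, q s (set_coord x s b) = q s x.

(** Within a pair, resampling splits the total mass in the ratio [q s x] to [1 - q s x], which is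
    how [m] already splits it. *)
Lemma sum_resample m q s g : conditional_of m q -> single_site q ->
  \sum_x m x * resample q s g x = \sum_x m x * g x.
Proof.
move=> mq qs; rewrite !(sum_cube_pair s); apply: eq_bigr => x _.
rewrite /resample !set_coordK !qs; have := mq s x.
set a := m _; set b := m _ => qab.
set g1 := g _; set g0 := g _.
transitivity (q s x * (a + b) * g1 + (a + b - q s x * (a + b)) * g0); first by ring.
by rewrite qab; ring.
Qed.

(** Under [m], the mean of [g] equals the mean of its resampling by [q']. Substituting this for the
    subtracted [g] leaves the difference of two resamplings, [(q s x - q' s x) * Delta s g x].
    Taking [q' = q] gives invariance; taking the rates of [X] and [Y] gives the comparison. *)
Lemma sum_glauber_generator m q q' g : conditional_of m q' -> single_site q' ->
  \sum_x m x * glauber_generator q g x =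
  N%:R^-1 * \sum_x m x * \sum_s (q s x - q' s x) * Delta s g x.
Proof.
move=> mq qs; under eq_bigr do rewrite glauber_generatorE mulrCA mulr_sumr.
rewrite -mulr_sumr; congr (_ * _); rewrite exchange_big/=.
under [RHS]eq_bigr do rewrite mulr_sumr.
rewrite [RHS]exchange_big/=; apply: eq_bigr => s _.
under eq_bigr do rewrite mulrBr.
rewrite sumrB -(sum_resample s g mq qs) -sumrB.
by apply: eq_bigr => x _; rewrite /resample /Delta; ring.
Qed.

Lemma sum_iter_glauber_step m q k g : conditional_of m q -> single_site q ->
  \sum_x m x * iter k (glauber_step q) g x = \sum_x m x * g x.
Proof.
move=> mq qs; elim: k => [//|k <-]; rewrite iterS.
under eq_bigr do rewrite /glauber_step mulrDr.
rewrite big_split/= (sum_glauber_generator _ _ mq qs).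
rewrite [X in _ + _ * X]big1 ?mulr0 ?addr0// => x _.
by rewrite big1 ?mulr0// => s _; rewrite subrr mul0r.
Qed.

Lemma influence_ge0 q r s : 0 <= influence_matrix q r s.
Proof. by rewrite mxE bigmax_ge_id. Qed.

(** Two copies differing at [r] are resampled at [s]. If [s = r] they coalesce. Otherwise they
    either agree at [s], leaving a difference at [r], or disagree there with probability
    [|q1 - q0|], which costs an extra [Delta s g]. *)
Lemma norm_Delta_resample q g r s x :
  (forall s x, 0 <= q s x <= 1) -> single_site q ->
  `|Delta r (resample q s g) x| <=
  (s != r)%:R * supnorm (Delta r g) +
  influence_matrix q s r * supnorm (Delta s g).
Proof.
move=> q01 qs; have [->|sr]/= := eqVneq s r.
  rewrite /Delta /resample !set_coordK !qs subrr normr0.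
  by rewrite mul0r add0r mulr_ge0// ?influence_ge0 ?supnorm_ge0.
rewrite mul1r.
pose q1 := q s (set_coord x r true); pose q0 := q s (set_coord x r false).
have -> : Delta r (resample q s g) x =
    q1 * Delta r g (set_coord x s true) +
    (1 - q1) * Delta r g (set_coord x s false) +
    (q1 - q0) * Delta s g (set_coord x r false).
  rewrite /Delta /resample !(set_coordC _ _ _ sr) -/q1 -/q0; ring.
have /andP[q1_ge0 q1_le1] := q01 s (set_coord x r true).
apply: le_trans (ler_normD _ _) _; apply: lerD.
  apply: le_trans (ler_normD _ _) _; rewrite !normrM.
  rewrite (ger0_norm q1_ge0) (@ger0_norm _ (1 - _)) ?subr_ge0//.
  set D := supnorm _; have -> : D = q1 * D + (1 - q1) * D by ring.
  by rewrite lerD// ler_wpM2l ?subr_ge0// norm_le_supnorm.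
rewrite normrM ler_pM//; last exact: norm_le_supnorm.
rewrite mxE.
exact: (le_bigmax _ (fun x => `|q s (set_coord x r true) - q s (set_coord x r false)|)).
Qed.

Lemma supnorm_Delta_glauber_step q g r : (0 < N)%N ->
  (forall s x, 0 <= q s x <= 1) -> single_site q ->
  supnorm (Delta r (glauber_step q g)) <=
  (1 - N%:R^-1) * supnorm (Delta r g) +
  N%:R^-1 * \sum_s influence_matrix q s r * supnorm (Delta s g).
Proof.
move=> N0 q01 qs.
have N_gt0 : 0 < N%:R :> R by rewrite ltr0n.
have sumE : \sum_s ((s != r)%:R * supnorm (Delta r g) +
      influence_matrix q s r * supnorm (Delta s g)) =
    N%:R * ((1 - N%:R^-1) * supnorm (Delta r g) +
      N%:R^-1 * \sum_s influence_matrix q s r * supnorm (Delta s g)).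
  (* The site [s = r] drops out of the first sum, so it counts [N - 1] sites, that is
     [N * (1 - 1/N)]. *)
  rewrite big_split/= -mulr_suml mulrDr mulVKf ?gt_eqF// mulrA; congr (_ * _ + _).
  rewrite (bigD1 r)//= eqxx add0r.
  under eq_bigr => s sr do rewrite sr.
  rewrite sumr_const cardC1 card_ord mulrBr mulr1 mulfV ?gt_eqF//.
  by rewrite -subn1 natrB.
apply: supnorm_le => [|x].
  rewrite -(pmulr_rge0 _ N_gt0) -sumE sumr_ge0// => s _.
  by rewrite addr_ge0// mulr_ge0// ?supnorm_ge0 ?influence_ge0.
have -> : Delta r (glauber_step q g) x =
    N%:R^-1 * \sum_s Delta r (resample q s g) x.
  by rewrite /Delta !glauber_stepE// -mulrBr sumrB.
rewrite normrM ger0_norm ?invr_ge0 ?(ltW N_gt0)// ler_pdivrMl// -sumE.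
apply: le_trans (ler_norm_sum _ _ _) _; apply: ler_sum => s _.
exact: norm_Delta_resample.
Qed.

End Resample.

(** * Contraction of the iterates and comparison of means *)

Section Contraction.
Context {R : realType} {N : nat}.
Variables (q : 'I_N -> cube N -> R) (M : 'M[R]_N) (p : \bar R) (eps : R).
Hypotheses (N_gt0 : (0 < N)%N) (p_ge1 : (1 <= p)%E).
Hypotheses (q01 : forall s x, 0 <= q s x <= 1) (q_site : single_site q).
Hypothesis infl_le : forall r s, influence_matrix q r s <= M r s.
Hypotheses (eps_gt0 : 0 < eps) (M_norm : op_pnorm p M <= 1 - eps).

(** Only one site in [N] is resampled per step, so the gain per step is [eps / N] rather than
    [eps]. *)
Let rate : R := 1 - N%:R^-1 * eps.

Let invN_gt0 : 0 < N%:R^-1 :> R.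
Proof. by rewrite invr_gt0 ltr0n. Qed.

Let invN_le1 : N%:R^-1 <= 1 :> R.
Proof. by rewrite invf_le1 ?ltr0n// ler1n. Qed.

(** Testing [M] on the all-ones vector, nonzero since [0 < N], shows that the bound [1 - eps] on its
    operator norm is nonnegative. This keeps [rate] nonnegative. *)
Let eps_le1 : eps <= 1.
Proof.
rewrite -subr_ge0 (le_trans _ M_norm)//.
have one_neq0 : (const_mx 1 : 'cV[R]_N) != 0.
  by apply/eqP => /matrixP/(_ (Ordinal N_gt0) 0)/eqP; rewrite !mxE oner_eq0.
have one_gt0 : 0 < pnorm p (const_mx 1 : 'cV[R]_N) by rewrite pnorm_gt0.
rewrite -(pmulr_lge0 _ one_gt0).
by apply: le_trans (pnorm_mulmx_le _ _ p_ge1); exact: pnorm_ge0.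
Qed.

Let rate_ge0 : 0 <= rate.
Proof. by rewrite subr_ge0 mulr_ile1// ltW. Qed.

Let rate_lt1 : rate < 1.
Proof. by rewrite ltrBlDr ltrDl mulr_gt0. Qed.

Let M_ge0 r s : 0 <= M r s.
Proof. exact: le_trans (influence_ge0 _ _ _) (infl_le _ _). Qed.

(** Induction on [k] with [u] general: by duality each step moves the matrix from the sup-norm
    vector onto the weight [u]. There [M] acts untransposed, so its [p]-norm bound applies
    directly. *)
Lemma weighted_supnorm_Delta_iter h k (u : 'cV[R]_N) : (forall i, 0 <= u i 0) ->
  \sum_s u s 0 * supnorm (Delta s (iter k (glauber_step q) h)) <=
  pnorm (hoelder_conjugate p) (\col_s supnorm (Delta s h)) *
    (rate ^+ k * pnorm p u).
Proof.
elim: k u => [|k IH] u u0.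
  rewrite expr0 mul1r; apply: le_trans (hoelder_pnorm _ _ p_ge1).
  apply: ler_sum => s _; rewrite mxE mulrC.
  by rewrite !ger0_norm// supnorm_ge0.
rewrite iterS; set g := iter k _ h.
(* The new weight; it stays nonnegative because [M] dominates the nonnegative influence matrix. *)
pose Ku : 'cV[R]_N := (1 - N%:R^-1) *: u + N%:R^-1 *: (M *m u).
have Ku_ge0 i : 0 <= Ku i 0.
  rewrite !mxE addr_ge0// mulr_ge0 ?subr_ge0 ?(ltW invN_gt0)//.
  by rewrite sumr_ge0// => j _; rewrite mulr_ge0.
have Ku_le : pnorm p Ku <= rate * pnorm p u.
  apply: le_trans (pnormD _ _ p_ge1) _.
  rewrite !pnormZ ?subr_ge0 ?(ltW invN_gt0)//.
  have -> : rate * pnorm p u =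
      (1 - N%:R^-1) * pnorm p u + N%:R^-1 * ((1 - eps) * pnorm p u).
    by rewrite /rate; ring.
  rewrite lerD// ler_wpM2l ?(ltW invN_gt0)//.
  apply: le_trans (pnorm_mulmx_le _ _ p_ge1) _.
  by rewrite ler_wpM2r ?pnorm_ge0.
apply: le_trans (_ : \sum_s Ku s 0 * supnorm (Delta s g) <= _); last first.
  apply: le_trans (IH _ Ku_ge0) _.
  by rewrite ler_wpM2l ?pnorm_ge0// exprSr -mulrA ler_wpM2l// exprn_ge0.
apply: le_trans (_ : \sum_r u r 0 * ((1 - N%:R^-1) * supnorm (Delta r g) +
    N%:R^-1 * \sum_s M s r * supnorm (Delta s g)) <= _).
  apply: ler_sum => r _; rewrite ler_wpM2l//.
  apply: le_trans (supnorm_Delta_glauber_step _ _ N_gt0 q01 q_site) _.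
  rewrite lerD// ler_wpM2l ?(ltW invN_gt0)// ler_sum// => s _.
  by rewrite ler_wpM2r ?supnorm_ge0.
rewrite le_eqVlt; apply/orP; left; apply/eqP.
under eq_bigr do rewrite mulrDr.
under [RHS]eq_bigr do rewrite !mxE mulrDl.
rewrite !big_split/=; congr (_ + _).
  by apply: eq_bigr => r _; rewrite mulrCA mulrA.
under eq_bigr do rewrite mulrCA mulr_sumr mulr_sumr.
rewrite exchange_big/=; apply: eq_bigr => s _.
rewrite -mulr_sumr -mulrA mulr_suml; congr (_ * _); apply: eq_bigr => r _.
by rewrite mulrCA mulrA.
Qed.

(** Telescoping over the steps yields a geometric sum, so the bound is uniform in [k]. *)
Lemma norm_mean_iter_le (n : cube N -> R) (q' : 'I_N -> cube N -> R) h k :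
  (forall x, 0 <= n x) -> conditional_of n q' -> single_site q' ->
  `|\sum_x n x * iter k (glauber_step q) h x - \sum_x n x * h x| <=
  eps^-1 * pnorm (hoelder_conjugate p) (\col_s supnorm (Delta s h)) *
    \sum_x n x * pnorm p (\col_s `|q s x - q' s x|).
Proof.
move=> n0 nq' q's.
set C := pnorm _ _; set V := \sum_x _ * pnorm _ _.
have V_ge0 : 0 <= V by rewrite sumr_ge0// => x _; rewrite mulr_ge0 ?pnorm_ge0.
pose a j := \sum_x n x * iter j (glauber_step q) h x.
have step_le j : `|a j.+1 - a j| <= N%:R^-1 * C * V * rate ^+ j.
  rewrite /a -sumrB.
  under eq_bigr do rewrite iterS -mulrBr /glauber_step addrC addKr.
  rewrite (sum_glauber_generator _ _ nq' q's) normrM ger0_norm ?(ltW invN_gt0)//.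
  rewrite -!mulrA ler_wpM2l ?(ltW invN_gt0)//.
  apply: le_trans (ler_norm_sum _ _ _) _.
  rewrite mulrCA mulr_suml; apply: ler_sum => x _.
  rewrite normrM (ger0_norm (n0 x)) -mulrA ler_wpM2l//.
  rewrite mulrCA [X in _ <= _ * X]mulrC.
  (* For each fixed [x], the discrepancies [|q s x - q' s x|] serve as the weight vector. *)
  apply: le_trans (weighted_supnorm_Delta_iter h j _); last first.
    by move=> i; rewrite mxE.
  apply: le_trans (ler_norm_sum _ _ _) _; apply: ler_sum => s _.
  by rewrite normrM mxE ler_wpM2l// norm_le_supnorm.
have -> : \sum_x n x * h x = a 0 by [].
rewrite -telescope_sumr//.
apply: le_trans (ler_norm_sum _ _ _) _.
apply: le_trans (ler_sum _ (fun j _ => step_le j)) _.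
rewrite -mulr_sumr big_mkord.
have geo : N%:R^-1 * eps * (\sum_(i < k) rate ^+ i) = 1 - rate ^+ k.
  by rewrite -[1 - _ in RHS]opprB subrX1 -mulNr opprB /rate subKr.
have -> : N%:R^-1 * C * V * (\sum_(i < k) rate ^+ i) =
    eps^-1 * C * V * (N%:R^-1 * eps * \sum_(i < k) rate ^+ i).
  by field; rewrite (gt_eqF eps_gt0) pnatr_eq0 -lt0n N_gt0.
rewrite geo -[leRHS]mulr1 ler_wpM2l//.
  by rewrite !mulr_ge0 ?pnorm_ge0// invr_ge0 ltW.
by rewrite lerBlDr lerDl exprn_ge0.
Qed.

(** The left side is free of [k], so bounding it by [B + b * rate ^+ k] for every [k] and letting
    [k] grow removes the second term. *)
Lemma mean_diff_le (m n : cube N -> R) (q' : 'I_N -> cube N -> R) h :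
  (forall x, 0 <= m x) -> \sum_x m x = 1 -> conditional_of m q ->
  (forall x, 0 <= n x) -> \sum_x n x = 1 -> conditional_of n q' ->
  single_site q' ->
  `|\sum_x m x * h x - \sum_x n x * h x| <=
  eps^-1 * pnorm (hoelder_conjugate p) (\col_s supnorm (Delta s h)) *
    \sum_x n x * pnorm p (\col_s `|q s x - q' s x|).
Proof.
move=> m0 m1 mq n0 n1 nq' q's; set B := (X in _ <= X).
set C := pnorm (hoelder_conjugate p) (\col_s supnorm (Delta s h)).
(* The 2 comes from comparing both means with one value [g x0]; the all-ones weight turns the
   weighted estimate into a bound on the oscillation. *)
pose b := 2 * (C * pnorm p (const_mx 1 : 'cV[R]_N)).
have le_rate k : `|\sum_x m x * h x - \sum_x n x * h x| <= B + b * rate ^+ k.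
  set g := iter k (glauber_step q) h.
  rewrite -(sum_iter_glauber_step k h mq q_site) -/g.
  apply: le_trans (ler_distD (\sum_x n x * g x) _ _) _; rewrite addrC.
  apply: lerD; first exact: norm_mean_iter_le.
  pose x0 : cube N := [tuple false | _ < N].
  apply: le_trans (ler_distD (g x0) _ _) _; rewrite (distrC (g x0)).
  apply: le_trans (lerD (norm_mean_sub_cube g x0 m0 m1)
                        (norm_mean_sub_cube g x0 n0 n1)) _.
  rewrite -mulr2n -mulr_natl /b -[leRHS]mulrA ler_wpM2l// -mulrA [X in _ * X]mulrC.
  apply: le_trans (weighted_supnorm_Delta_iter h k _); last first.
    by move=> i; rewrite mxE.
  by apply: ler_sum => s _; rewrite mxE mul1r.
have cvgB : (fun k => B + b * rate ^+ k) @ \oo --> B.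
  rewrite -[X in _ --> X]addr0 -(mulr0 b); apply: cvgD; first exact: cvg_cst.
  by apply: cvgMr; apply: cvg_expr; rewrite ger0_norm.
by apply: (cvgr_to_ge cvgB); apply: nearW.
Qed.

End Contraction.

(** * Law, expectation and conditional probabilities of a random cube vector *)

Section CubeLaw.
Context {d : measure_display} {T : measurableType d} {R : realType}.
Context {P : probability T R} {N : nat} (X : {RV P >-> cube N}).
Implicit Types (x : cube N) (s : 'I_N) (g : cube N -> R).

Definition law_weight x : R := fine (P (X @^-1` [set x])).

(** A point of the cube is cut out by finitely many coordinate events, each measurable. *)
Lemma measurable_preimage_cube1 x : measurable (X @^-1` [set x]).
Proof.
have -> : X @^-1` [set x] =
    \bigcap_(i in [set: 'I_N]) (X @^-1` ((@tnth N bool)^~ i @^-1` [set tnth x i])).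
  apply/seteqP; split=> [w /= Xw i _|w /= Xw]; first by rewrite /= Xw.
  by apply: eq_from_tnth => i; exact: Xw.
apply: fin_bigcap_measurable => // i _.
rewrite -(setTI (X @^-1` _)); apply: measurable_funPT => //.
rewrite -(setTI (_ @^-1` _)); exact: measurable_tnth.
Qed.

Lemma measurable_preimage_cube (B : set (cube N)) : measurable (X @^-1` B).
Proof.
have -> : X @^-1` B = \bigcup_(x in B) (X @^-1` [set x]).
  apply/seteqP; split=> [w Bw|w [x /[swap] /= <- //]].
  by exists (X w).
apply: fin_bigcup_measurable => [|x _]; first exact: finite_finset.
exact: measurable_preimage_cube1.
Qed.

Lemma law_weight_ge0 x : 0 <= law_weight x.
Proof. exact: fine_ge0. Qed.

Lemma law_weightE x : (law_weight x)%:E = P (X @^-1` [set x]).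
Proof. by rewrite fineK// fin_num_measure//; exact: measurable_preimage_cube1. Qed.

(** The level sets of [X] form a finite measurable partition of [T], and the integrand is constant
    on each. *)
Lemma expectation_cube g : ('E_P[g \o X] = (\sum_x law_weight x * g x)%:E)%E.
Proof.
have cover : \big[setU/set0]_(x <- enum {: cube N}) (X @^-1` [set x]) = [set: T].
  rewrite -bigcup_seq; apply/seteqP; split=> // w _.
  by exists (X w) => //=; rewrite mem_enum.
rewrite unlock -cover integral_bigsetU_EFin/= ?cover.
- rewrite big_enum/= -sumEFin; apply: eq_bigr => x _.
  under eq_integral => w /[!inE] /= -> do [].
  rewrite integral_cst//=; last exact: measurable_preimage_cube1.
  by rewrite EFinM law_weightE muleC.
- exact: measurable_preimage_cube1.
- exact: enum_uniq.
- by move=> x y _ _ [w [/= <- <-]].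
- move=> _ B mB; rewrite setTI.
  exact: (measurable_preimage_cube ((EFin \o g) @^-1` B)).
Qed.

Lemma sum_law_weight : \sum_x law_weight x = 1.
Proof.
apply/EFin_inj; rewrite -(expectation_cst P 1) -[cst 1]/(cst 1 \o X).
by rewrite expectation_cube; congr EFin; apply: eq_bigr => x _; rewrite mulr1.
Qed.

Let fix_others s x : set T := [set w | forall u, u != s -> tnth (X w) u = tnth x u].

Let fix_othersE s x : fix_others s x =
  X @^-1` [set set_coord x s true] `|` X @^-1` [set set_coord x s false].
Proof.
apply/seteqP; split=> [w /= Xw|w].
  suff : X w = set_coord x s (tnth (X w) s) by case: (tnth _ s); [left|right].
  apply: eq_from_tnth => u; rewrite tnth_set_coord.
  by case: eqP => [->//|/eqP /Xw].
by case=> /= Xw u us; rewrite Xw tnth_set_coord (negbTE us).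
Qed.

Let prob_fix_others s x : fine (P (fix_others s x)) =
  law_weight (set_coord x s true) + law_weight (set_coord x s false).
Proof.
rewrite fix_othersE measureU ?fineD ?fin_num_measure//;
  try exact: measurable_preimage_cube1.
apply/seteqP; split=> // w [/= Xw]; rewrite Xw => /(congr1 (fun y => tnth y s)).
by rewrite !tnth_set_coord eqxx.
Qed.

Let prob_fix_others_set s x :
  fine (P ([set w | tnth (X w) s = true] `&` fix_others s x)) =
  law_weight (set_coord x s true).
Proof.
congr (fine (P _)); rewrite fix_othersE; apply/seteqP; split=> w /=.
  case=> Xs [//|/(congr1 (fun y => tnth y s))].
  by rewrite Xs tnth_set_coord eqxx.
by move=> Xw; rewrite Xw tnth_set_coord eqxx; split=> //; left.
Qed.

Lemma qcondE s x : qcond X s x =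
  law_weight (set_coord x s true) /
  (law_weight (set_coord x s true) + law_weight (set_coord x s false)).
Proof. by rewrite /qcond /cond_prob prob_fix_others_set prob_fix_others. Qed.

Lemma qcond_itv01 s x : 0 <= qcond X s x <= 1.
Proof.
rewrite qcondE; set a := law_weight _; set b := law_weight _.
have a0 : 0 <= a by exact: law_weight_ge0.
have b0 : 0 <= b by exact: law_weight_ge0.
rewrite divr_ge0 ?addr_ge0//=.
(* On a null conditioning event the quotient has its default value 0, which still lies in the
   interval. *)
have [->|ab0] := eqVneq (a + b) 0; first by rewrite invr0 mulr0.
by rewrite ler_pdivrMr ?lt0r ?ab0 ?addr_ge0// mul1r lerDl.
Qed.

Lemma single_site_qcond : single_site (qcond X).
Proof. by move=> s x b; rewrite !qcondE !set_coordK. Qed.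

Lemma conditional_of_qcond : conditional_of law_weight (qcond X).
Proof.
move=> s x; rewrite qcondE; set a := law_weight _; set b := law_weight _.
(* If the conditioning event is null, both nonnegative weights vanish and the identity reads
   [0 = 0]. *)
have [ab0|ab0] := eqVneq (a + b) 0; last by rewrite divfK.
apply/esym/eqP; rewrite ab0 mulr0.
by move/eqP: ab0; rewrite paddr_eq0 ?law_weight_ge0// => /andP[].
Qed.

End CubeLaw.

Theorem theorem2p1 (R : realType) (N : nat)
  (dX : measure_display) (TX : measurableType dX) (PX : probability TX R)
  (X : {RV PX >-> cube N})
  (dY : measure_display) (TY : measurableType dY) (PY : probability TY R)
  (Y : {RV PY >-> cube N})
  (h : cube N -> R)
  (irrX : glauber_irreducible (qcond X))
  (c : 'cV[R]_N) (c_def : c = \col_s supnorm (Delta s h))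
  (v : cube N -> 'cV[R]_N)
  (v_def : v = fun y => \col_s `|qcond X s y - qcond Y s y|)
  (M : 'M[R]_N) (p : \bar R) (eps : R)
  (p_ge1 : (1 <= p)%E) (eps_gt0 : 0 < eps)
  (infl_le : forall r s : 'I_N, influence_matrix (qcond X) r s <= M r s)
  (M_norm : op_pnorm p M <= 1 - eps) :
  (`| 'E_PX[h \o X] - 'E_PY[h \o Y] |
     <= (eps^-1 * pnorm (hoelder_conjugate p) c)%:E
        * 'E_PY[fun w => pnorm p (v (Y w))])%E.
Proof.
rewrite (expectation_cube Y (fun y => pnorm p (v y))) !expectation_cube.
rewrite -EFinB abse_EFin -EFinM lee_fin c_def v_def.
(* The contraction argument divides by [N]. For [N = 0] the cube is a single point, so [h] is
   constant and the left side is 0. *)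
have [N_gt0|] := ltnP 0 N; last first.
  rewrite leqn0 => /eqP N0; subst N.
  have [a ->] : exists a, h = cst a.
    exists (h [tuple]); apply/funext => y.
    by congr h; apply: eq_from_tnth => -[].
  rewrite -!mulr_suml !sum_law_weight subrr normr0.
  apply: mulr_ge0; first by rewrite mulr_ge0 ?pnorm_ge0// invr_ge0 ltW.
  by apply: sumr_ge0 => y _; rewrite mulr_ge0 ?pnorm_ge0 ?law_weight_ge0.
apply: (mean_diff_le N_gt0 p_ge1 (qcond_itv01 X) (single_site_qcond X) infl_le
  eps_gt0 M_norm).
- exact: law_weight_ge0.
- exact: sum_law_weight.
- exact: conditional_of_qcond.
- exact: law_weight_ge0.
- exact: sum_law_weight.
- exact: conditional_of_qcond.
- exact: single_site_qcond.
Qed.
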